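(* Let $n\ge 1$, let $a=(a_1,\ldots,a_n)$ and $b=(b_1,\ldots,b_n)$ be two $n$-tuples of positive integers, and let $X$ be a non-empty finite set of positive integers such that $\gcd(X\cup\{b_1,\ldots,b_n\})=1$. Then the following procedure stops after finitely many steps and returns $M(a,b,X)$. (1) Set $A=\emptyset$ and $G=X$. (2) If $G\setminus A=\emptyset$, then return $\langle G\rangle$ and stop. (3) Set $m=\min(G\setminus A)$. (4) Set $H=\{a_im+b_i \mid i\in\{1,\ldots,n\} \text{ and } a_im+b_i\notin\langle G\rangle\}$. (5) If $H=\emptyset$, then go to (7). (6) Set $G=G\cup H$. (7) Set $A=A\cup\{m\}$ and go to (2).
   Context: $\mathbb{N}$ is the set of non-negative integers. $\langle G\rangle$ denotes the submonoid of $(\mathbb{N},+)$ generated by $G$. A numerical semigroup is a submonoid $S$ of $(\mathbb{N},+)$ with $\mathbb{N}\setminus S$ finite. For $s\in\mathbb{N}$, $as+b=(a_1s+b_1,\ldots,a_ns+b_n)$. $\mathcal{N}(a,b,X)$ is the set of all numerical semigroups $S$ such that $X\subseteq S$ and $as+b\in S^n$ for all $s\in S\setminus\{0\}$. $M(a,b,X)=\bigcap_{S\in\mathcal{N}(a,b,X)}S$. *)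

(* Defs.v *)
From mathcomp Require Import all_boot finmap.
From mathcomp Require Import boolp classical_sets cardinality.

Set Implicit Arguments.
Unset Strict Implicit.
Unset Printing Implicit Defensive.

Local Open Scope classical_set_scope.
Local Open Scope fset_scope.
Local Open Scope nat_scope.

Definition submonoid (S : set nat) : Prop :=
  S 0 /\ forall x y, S x -> S y -> S (x + y).

Definition numerical_semigroup (S : set nat) : Prop :=
  submonoid S /\ finite_set (~` S).

Definition generated (G : {fset nat}) : set nat := smallest submonoid [set` G].

Definition affine n (a b : n.-tuple nat) (s : nat) : n.-tuple nat :=
  [tuple tnth a i * s + tnth b i | i < n].

(* N(a, b, X) *)
Definition family n (a b : n.-tuple nat) (X : {fset nat}) : set (set nat) :=
  [set S | [/\ numerical_semigroup S,
               ([set` X] `<=` S)%classic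
             & forall s, S s -> s <> 0 -> forall i, S (tnth (affine a b s) i)]].

(* M(a, b, X) *)
Definition family_meet n (a b : n.-tuple nat) (X : {fset nat}) : set nat :=
  \bigcap_(S in family a b X) S.

(* Running A G is the state of the procedure when it is about to test whether
   G \ A is empty; Returned S is the state where it has stopped with output S. *)
Inductive state : Type :=
  | Running of {fset nat} & {fset nat}
  | Returned of set nat.

(* Membership in generated G is decided classically. *)
Definition new_elements n (a b : n.-tuple nat) (G : {fset nat}) (m : nat) :
    {fset nat} :=
  [fset tnth (affine a b m) i | i in 'I_n
     & tnth (affine a b m) i \notin generated G].

(* One pass through the loop. Matching on fset0Pn tests whether G \ A is empty,
   and otherwise gives ex_minn the proof it needs that the minimum exists.
   Returned states are fixed points. *)
Definition step n (a b : n.-tuple nat) (st : state) : state :=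
  match st with
  | Returned _ => st
  | Running A G =>
      match @fset0Pn _ (G `\` A) with
      | ReflectF _ => Returned (generated G)
      | ReflectT exGA =>
          let m := ex_minn exGA in
          let H := new_elements a b G m in
          Running (m |` A) (if H == fset0 then G else G `|` H)
      end
  end.

(* Main.v *)
Require Import Defs.
From mathcomp Require Import all_boot finmap.
From mathcomp Require Import boolp classical_sets cardinality.

Set Implicit Arguments.
Unset Strict Implicit.
Unset Printing Implicit Defensive.

Local Open Scope fset_scope.
Local Open Scope nat_scope.

(** At every stage [X] is contained in [G], and [G] in every member of the
    family.  If the procedure stops, [a_i g + b_i] lies in [<G>] for each
    generator [g], hence for every nonzero element, as
    [a_i (g + t) + b_i = (a_i g + b_i) + a_i t].  A common divisor of [<G>]
    divides [X], then every [b_i = (a_i x + b_i) - a_i x], so it is [1] and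
    [<G>] is a numerical semigroup; thus [<G>] is the least member of the family.
    If the procedure ran forever, the ascending chain of submonoids [<G>] would
    stabilize; from then on [H] is empty, so [G] is constant while its subset [A]
    gains an element at each pass, which is impossible. *)

(** * Submonoids of the natural numbers *)

Lemma submonoid_muln (S : set nat) k x : submonoid S -> S x -> S (k * x).
Proof. by move=> [S0 SD] Sx; elim: k => // k IH; rewrite mulSn; apply: SD. Qed.

Lemma generated_submonoid (G : {fset nat}) : submonoid (generated G).
Proof.
split; first by move=> S [[S0 _] _].
by move=> x y Gx Gy S [mS GS]; case: (mS) => _; apply; [apply: Gx|apply: Gy].
Qed.

Lemma sub_generated (G : {fset nat}) x : x \in G -> generated G x.
Proof. by move=> Gx S [_]; apply. Qed.

Lemma generated_sub (G : {fset nat}) (S : set nat) :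
  submonoid S -> (forall x, x \in G -> S x) -> (generated G `<=` S)%classic.
Proof. by move=> mS GS x; apply. Qed.

(** With gcd 1 there are two consecutive elements [y] and [y.+1], whose combinations reach every
    number from [y * y] on. *)
Lemma submonoid_cofinite (S : set nat) :
  submonoid S -> (forall d, (forall s, S s -> d %| s) -> d = 1) ->
  finite_set (~` S)%classic.
Proof.
move=> mS gcdS; have [S0 SD] := mS.
(* The least positive difference of two elements divides every element. *)
have [y Sy Sy1] : exists2 y, S y & S y.+1.
  pose P d := (0 < d) && `[< exists2 y, S y & S (y + d) >].
  have exP : exists d, P d.
    (* Without such a difference [S] is [{0}], and 2 divides all its elements. *)
    apply: contrapT => noP; suff: 2 = 1 by [].
    apply: gcdS => -[//|s Ss]; case: noP; exists s.+1.
    by apply/andP; split=> //; apply/asboolP; exists 0.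
  case: (ex_minnP exP) => d /andP[d0 /asboolP[y Sy Syd]] dmin.
  suff d1 : d = 1 by exists y; rewrite // -addn1 -d1.
  apply: gcdS => s Ss; apply/negPn/negP; rewrite /dvdn -lt0n => r0.
  suff /dmin : P (s %% d) by rewrite leqNgt ltn_mod d0.
  (* This element and [s %/ d * y + s] both lie in [S], and they differ by [s %% d], which is below
     the minimum [d]. *)
  rewrite /P r0; apply/asboolP; exists (s %/ d * (y + d)).
    exact: submonoid_muln.
  rewrite mulnDr -addnA -divn_eq.
  by apply: SD => //; apply: submonoid_muln.
apply: (@sub_finite_set _ _ `I_(y * y)); last exact: finite_II.
move=> x /= nSx; rewrite ltnNge; apply/negP => xge; apply: nSx.
case: y => [|y] in Sy Sy1 xge *.
  by rewrite -(muln1 x); apply: submonoid_muln.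
have rlt : x %% y.+1 < y.+1 by rewrite ltn_mod.
have qge : y.+1 <= x %/ y.+1 by rewrite leq_divRL.
(* The bound on [x] makes the quotient exceed the remainder, so the truncated subtraction is exact:
   each unit of the remainder turns one [y.+1] into [y.+2]. *)
have -> : x = (x %/ y.+1 - x %% y.+1) * y.+1 + x %% y.+1 * y.+2.
  rewrite (mulnS _ y.+1) [X in _ + X]addnC addnA -mulnDl subnK ?(leq_trans (ltnW rlt)) //.
  exact: divn_eq.
by apply: SD; apply: submonoid_muln.
Qed.

(* The Apery set: one least element per residue class modulo a fixed positive
   element, together with that element, generates. *)
Lemma submonoid_fg (S : set nat) :
  submonoid S -> exists F : {fset nat}, S = generated F.
Proof.
move=> mS; have [S0 SD] := mS.
have [[p p0 Sp]|noS] := pselect (exists2 p, 0 < p & S p); last first.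
  exists fset0; apply/seteqP; split; last exact: generated_sub.
  move=> [|x Sx]; last by case: noS; exists x.+1.
  by have [] := generated_submonoid fset0.
have /choice[w Hw] r : exists w, S w /\
    (forall s, S s -> s = r %[mod p] -> w = r %[mod p] /\ w <= s).
  have [exr|nor] := pselect (exists s, `[< S s /\ s = r %[mod p] >]); last first.
    (* For a residue class that misses [S], 0 is a harmless placeholder in [S]. *)
    by exists 0; split=> // s Ss sr; case: nor; exists s; apply/asboolP.
  case: (ex_minnP exr) => w /asboolP[Sw wr] wmin.
  by exists w; split=> // s Ss sr; split=> //; apply: wmin; apply/asboolP.
exists (p |` [fset w i | i in iota 0 p]); set F := _ |` _.
have [_ FD] := generated_submonoid F.
apply/seteqP; split; last first.
  apply: generated_sub => // x; rewrite !inE => /orP[/eqP->//|/imfsetP[i _ ->]].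
  by case: (Hw i).
move=> s Ss; have [Sw /(_ s Ss)[|ws wles]] := Hw (s %% p).
  by rewrite modn_mod.
have /dvdnP[q sq] : p %| s - w (s %% p).
  by rewrite -eqn_mod_dvd // ws modn_mod.
rewrite -(subnK wles) sq; apply: FD.
  apply: (submonoid_muln _ (generated_submonoid F)).
  by apply: sub_generated; rewrite !inE eqxx.
apply: sub_generated; rewrite !inE; apply/orP; right; apply/imfsetP => /=.
by exists (s %% p); rewrite // mem_iota add0n ltn_mod.
Qed.

(** The union of the chain is a submonoid, hence finitely generated; once all its generators have
    appeared, the chain equals the union. *)
Lemma submonoid_chain_stable (T : nat -> set nat) :
  (forall k, submonoid (T k)) -> (forall k, (T k `<=` T k.+1)%classic) ->
  exists N, forall k, N <= k -> T k = T N.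
Proof.
move=> mT Tinc.
have Tle j k : j <= k -> (T j `<=` T k)%classic.
  move=> /subnK <-; elim: (k - j) => // d IH x Tx.
  by rewrite addSn; apply: Tinc; apply: IH.
pose U : set nat := (fun x => exists k, T k x).
have mU : submonoid U.
  split; first by exists 0; case: (mT 0).
  move=> x y [j Tx] [k Ty]; exists (maxn j k).
  have [_] := mT (maxn j k); apply; first by apply: Tle Tx; rewrite leq_maxl.
  by apply: Tle Ty; rewrite leq_maxr.
have [F UF] := submonoid_fg mU.
have /choice[f Hf] x : exists k, x \in F -> T k x.
  have [xF|] := boolP (x \in F); last by exists 0.
  by have := sub_generated xF; rewrite -UF => -[k Tx]; exists k.
exists (\max_(x <- F) f x) => k Nk; apply/seteqP; split; last exact: Tle.
move=> x Tx; have : U x by exists k.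
rewrite UF; apply: generated_sub => // y Fy.
by apply: Tle (Hf _ Fy); apply: leq_bigmax_seq.
Qed.

(** * Invariant and termination of the procedure *)

Section Procedure.

Variables (n : nat) (a b : n.-tuple nat) (X : {fset nat}).

Lemma tnth_affine m i : tnth (affine a b m) i = tnth a i * m + tnth b i.
Proof. exact: tnth_mktuple. Qed.

(** When no new element arises, the union with the empty set is [G], so both outcomes of that test
    take one form. *)
Lemma stepP (A G : {fset nat}) :
  (G `\` A = fset0 /\ step a b (Running A G) = Returned (generated G)) \/
  (exists2 m, m \in G `\` A & step a b (Running A G) =
     Running (m |` A) (G `|` new_elements a b G m)).
Proof.
rewrite /step; case: fset0Pn => [exGA|noGA].
  right; case: (ex_minnP exGA) => m mGA _; exists m => //.
  by case: eqP => // ->; rewrite fsetU0.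
left; split=> //; apply/eqP/negPn/negP => /fset0Pn; exact: noGA.
Qed.

Lemma new_elementsP G m x :
  reflect (exists2 i, x = tnth a i * m + tnth b i & ~ generated G x)
    (x \in new_elements a b G m).
Proof.
apply: (iffP idP) => [/imfsetP[i /= nGi ->]|[i -> nGi]].
  exists i; rewrite tnth_affine //.
  by move=> /mem_set inG; move: nGi; rewrite !inE tnth_affine inG.
apply/imfsetP; exists i; last by rewrite tnth_affine.
by rewrite /= !inE tnth_affine; apply/negP => /set_mem.
Qed.

(** Positivity is kept because members of the family are closed only at nonzero elements. The last
    clause survives as [G] grows, and covers all of [G] once [A] exhausts it. *)
Definition procedure_invariant (A G : {fset nat}) : Prop :=
  [/\ A `<=` G, X `<=` G, forall x, x \in G -> 0 < x,
      forall S, Defs.family a b X S -> forall x, x \in G -> S x &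
      forall m i, m \in A -> generated G (tnth a i * m + tnth b i)].

Hypotheses (hb : forall i, 0 < tnth b i) (hXpos : forall x, x \in X -> 0 < x).

Lemma invariant_init : procedure_invariant fset0 X.
Proof. by split=> // S [_ XS _] x /XS. Qed.

Lemma invariant_step A G m : m \in G `\` A -> procedure_invariant A G ->
  procedure_invariant (m |` A) (G `|` new_elements a b G m).
Proof.
rewrite in_fsetD => /andP[_ mG] [AG XG Gpos GM Acl].
have sub x : generated G x -> generated (G `|` new_elements a b G m) x.
  apply: generated_sub; first exact: generated_submonoid.
  by move=> y Gy; apply: sub_generated; rewrite in_fsetU Gy.
split.
- by rewrite fsubUset fsub1set in_fsetU mG (fsubset_trans AG) ?fsubsetUl.
- by rewrite (fsubset_trans XG) ?fsubsetUl.
- move=> x; rewrite in_fsetU => /orP[/Gpos//|/new_elementsP[i -> _]].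
  by rewrite addn_gt0 hb orbT.
- move=> S FS x; rewrite in_fsetU => /orP[/(GM _ FS)//|/new_elementsP[i -> _]].
  have [_ _ Scl] := FS; rewrite -tnth_affine.
  by apply: Scl; [exact: GM|move=> m0; have := Gpos _ mG; rewrite m0].
- move=> k i; rewrite in_fset1U => /orP[/eqP->|/(Acl k i)/sub//].
  have [/sub//|nG] := pselect (generated G (tnth a i * m + tnth b i)).
  apply: sub_generated; rewrite in_fsetU; apply/orP; right.
  by apply/new_elementsP; exists i.
Qed.

Lemma procedure_terminates : exists k A G, procedure_invariant A G /\
  G `\` A = fset0 /\
  iter k (step a b) (Running fset0 X) = Returned (generated G).
Proof.
apply: contrapT => never.
have run k : exists AG : {fset nat} * {fset nat},
    iter k (step a b) (Running fset0 X) = Running AG.1 AG.2 /\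
    procedure_invariant AG.1 AG.2.
  elim: k => [|k [[A G] /= [stk invk]]].
    by exists (fset0, X); split=> //; exact: invariant_init.
  case: (stepP A G) => [[GA0 stS]|[m mGA stS]].
    by case: never; exists k.+1, A, G; rewrite /= stk.
  exists (m |` A, G `|` new_elements a b G m); rewrite /= stk.
  by split; [|exact: invariant_step].
have {run} /choice[AG run] := run.
pose A k := (AG k).1; pose G k := (AG k).2.
have next k : exists2 m, m \in G k `\` A k &
    A k.+1 = m |` A k /\ G k.+1 = G k `|` new_elements a b (G k) m.
  have [stk invk] := run k; have [+ _] := run k.+1; rewrite iterS stk.
  case: (stepP (AG k).1 (AG k).2) => [[_ ->]//|[m mGA ->]] [A1 G1].
  by exists m; rewrite // /A /G -A1 -G1.
have [k|k x|N stab] := @submonoid_chain_stable (fun k => generated (G k)).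
- exact: generated_submonoid.
- apply: generated_sub; first exact: generated_submonoid.
  move=> y Gy; apply: sub_generated.
  by have [m _ [_ ->]] := next k; rewrite in_fsetU Gy.
(* A new element would lie outside the current submonoid but inside the next one, which is the
   same. *)
have Gstab j : G (N + j) = G N.
  elim: j => [|j IH]; first by rewrite addn0.
  rewrite addnS -IH; have [m _ [_ Gnext]] := next (N + j).
  rewrite Gnext; apply/fsetUidPl/fsubsetP => x xH.
  have [i _ []] := new_elementsP _ _ _ xH.
  rewrite (stab (N + j)) ?leq_addr // -(stab (N + j).+1) ?leqW ?leq_addr //.
  by apply: sub_generated; rewrite Gnext in_fsetU xH orbT.
have Acard j : j <= #|` A (N + j)|.
  elim: j => // j IH; rewrite addnS; have [m mGA [-> _]] := next (N + j).
  by move: mGA; rewrite in_fsetD cardfsU1 => /andP[-> _].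
(* One pass more than [G N] has elements makes [A] too large to be a subset. *)
have [_ [/fsubset_leq_card + _ _ _ _]] := run (N + #|` G N|.+1).
rewrite -/(A _) -/(G _) Gstab => le.
by have := leq_trans (Acard _) le; rewrite ltnn.
Qed.

Lemma generated_affine_closed (G : {fset nat}) :
  (forall m i, m \in G -> generated G (tnth a i * m + tnth b i)) ->
  forall s, generated G s -> s <> 0 ->
    forall i, generated G (tnth a i * s + tnth b i).
Proof.
move=> Gcl s Gs s0 i; have mG := generated_submonoid G; have [G0 GD] := mG.
(* Membership is carried along because the sum step also uses that multiples of [y] lie in the
   submonoid. *)
suff : (generated G `<=` [set s | generated G s /\
    (s <> 0 -> generated G (tnth a i * s + tnth b i))])%classic.
  by move=> /(_ s Gs)[_]; apply.
refine (generated_sub _ _) => [|x xG]; last first.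
  by split; [exact: sub_generated|move=> _; exact: Gcl].
split=> [|x y [Gx clx] [Gy cly]]; first by split.
split=> [|xy0]; first exact: GD.
have [x0|/eqP x0] := eqVneq x 0; first by rewrite x0 in xy0 *; apply: cly.
rewrite mulnDr addnAC; apply: GD; first exact: clx.
exact: (submonoid_muln _ mG).
Qed.

End Procedure.

Theorem mainTheorem4 (n : nat) (hn : 1 <= n) (a b : n.-tuple nat)
    (ha : forall i, 0 < tnth a i) (hb : forall i, 0 < tnth b i)
    (X : {fset nat}) (hX : X != fset0) (hXpos : forall x, x \in X -> 0 < x)
    (hgcd : \big[gcdn/0]_(x <- X `|` [fset tnth b i | i in 'I_n]) x = 1) :
  exists k : nat,
    iter k (step a b) (Running fset0 X) = Returned (family_meet a b X).
Proof.
have [k [A [G [[AG XG Gpos GM Acl] [GA0 stk]]]]] :=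
  procedure_terminates a hb hXpos.
exists k; rewrite stk; congr Returned.
have GA : G `<=` A by rewrite -fsetD_eq0 GA0.
have mG := generated_submonoid G.
have Gcl s : generated G s -> s <> 0 ->
    forall i, generated G (tnth a i * s + tnth b i).
  by apply: generated_affine_closed => m i /(fsubsetP GA); exact: Acl.
have XGen x : x \in X -> generated G x.
  by move=> /(fsubsetP XG); exact: sub_generated.
apply/seteqP; split=> [x Gx S FS|x].
  by apply: generated_sub x Gx; [case: FS => -[]|exact: GM].
(* It suffices that [generated G] is itself a member of the family. *)
apply; split.
- split=> //; apply: submonoid_cofinite => // d dG.
  apply/eqP; rewrite -dvdn1 -hgcd big_seq.
  apply: (big_ind (fun z => d %| z)) => [//|y z dy dz|y].
    by rewrite dvdn_gcd dy.
  rewrite in_fsetU => /orP[/XGen/dG//|/imfsetP[i _ ->]].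
  have [x0 x0X] := fset0Pn _ hX.
  have x0n0 : x0 <> 0 by move=> x00; have := hXpos _ x0X; rewrite x00.
  have dax0 : d %| tnth a i * x0 by rewrite dvdn_mull ?(dG _ (XGen _ x0X)).
  rewrite -(dvdn_addr _ dax0); apply: dG.
  exact: (Gcl _ (XGen _ x0X) x0n0).
- by move=> x1; exact: XGen.
- by move=> s Gs s0 i; rewrite tnth_affine; exact: (Gcl _ Gs s0).
Qed.
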